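(* Let $(X,\|\cdot\|)$ be a Fréchet space whose F-norm is $s$-convex for some $s\in(0,1]$, and let $\{V_n\}_{n\in\mathbb{N}}$ be a nested sequence of linear subspaces of $X$ such that $\overline{V_n}\subsetneq V_{n+1}$ for every $n\in\mathbb{N}$. Let $\{e_n\}_{n\in\mathbb{N}}$ be a decreasing sequence of positive numbers tending to $0$. Then there exists $x\in X$ such that for every $n\in\mathbb{N}$ $$\frac{e_n}{3}\leq \mathrm{dist}(x,V_n)\leq 3e_n.$$
   Context: $\mathbb{N}=\{1,2,\dots\}$. A Fréchet space $(X,\|\cdot\|)$ is a (real or complex) metric linear space which is complete with respect to an F-norm $\|\cdot\|$ giving its topology; an F-norm satisfies $\|x\|=0$ iff $x=0$, $\|\alpha x\|=\|x\|$ for all scalars with $|\alpha|=1$, and $\|x+y\|\leq\|x\|+\|y\|$. The F-norm is called $s$-convex if $\|tx\|=|t|^s\|x\|$ for every $x\in X$ and every scalar $t$. Closures are taken with respect to $\|\cdot\|$, and $\mathrm{dist}(x,V)=\inf\{\|x-v\|:v\in V\}$. *)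

(* Defs.v *)
From HB Require Import structures.
From mathcomp Require Import all_boot all_order all_algebra.
From mathcomp Require Import complex.
From mathcomp Require Import all_classical all_reals all_analysis.

Set Implicit Arguments.
Unset Strict Implicit.
Unset Printing Implicit Defensive.

Import Order.TTheory GRing.Theory Num.Theory.
Import numFieldNormedType.Exports.

Local Open Scope classical_set_scope.
Local Open Scope ring_scope.

Inductive scalar_kind := RealScalars | ComplexScalars.

Definition scalars (R : realType) (k : scalar_kind) : numFieldType :=
  match k with
  | RealScalars => R
  | ComplexScalars => R[i]
  end.

(* The absolute value of a scalar, as an element of R in both cases: MathComp's
   own norm on R[i] takes its values in R[i]. *)
Definition modulus (R : realType) (k : scalar_kind) : scalars R k -> R :=
  match k return scalars R k -> R with
  | RealScalars => fun a : R => `|a|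
  | ComplexScalars => fun a : R[i] => complex.Re `|a|
  end.

Section Fnorm.
Context (R : realType) (k : scalar_kind).

(* Nonnegativity of N follows from the three axioms. *)
Record is_Fnorm (X : lmodType (scalars R k)) (N : X -> R) : Prop := IsFnorm {
  Fnorm_eq0 : forall x, N x = 0 <-> x = 0 ;
  Fnorm_unimodular : forall a x, modulus a = 1 -> N (a *: x) = N x ;
  Fnorm_triangle : forall x y, N (x + y) <= N x + N y
}.

Definition s_convex (X : lmodType (scalars R k)) (s : R) (N : X -> R) : Prop :=
  forall (t : scalars R k) (x : X), N (t *: x) = modulus t `^ s * N x.

Definition Fnorm_cauchy (X : lmodType (scalars R k)) (N : X -> R)
    (u : nat -> X) : Prop :=
  forall eps : R, 0 < eps ->
    exists M : nat, forall m n, (M <= m)%N -> (M <= n)%N -> N (u m - u n) < eps.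

(* Local convexity is deliberately not assumed, so X is a topologicalLmodType
   and not a tvsType, which MathComp-Analysis restricts to locally convex
   spaces. *)
Record is_Frechet (X : topologicalLmodType (scalars R k)) (N : X -> R) : Prop :=
  IsFrechet {
  Frechet_Fnorm : is_Fnorm N ;
  Frechet_nbhs : forall x : X, nbhs x = nbhs_ball_ (ball_ N) x ;
  Frechet_complete : forall u : nat -> X, Fnorm_cauchy N u ->
    exists l : X, u @ \oo --> l
}.

Definition dist (X : lmodType (scalars R k)) (N : X -> R) (x : X) (V : set X)
    : R :=
  inf [set N (x - v) | v in V].

End Fnorm.

(* Main.v *)
Require Import Defs.
From HB Require Import structures.
From mathcomp Require Import all_boot all_order all_algebra.
From mathcomp Require Import all_classical all_reals all_analysis.
From mathcomp Require Import complex ring lra.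

Set Implicit Arguments.
Unset Strict Implicit.
Unset Printing Implicit Defensive.

Import Order.TTheory GRing.Theory Num.Theory.
Import numFieldNormedType.Exports.

Local Open Scope classical_set_scope.
Local Open Scope ring_scope.

(** The point x is the sum of a series with one term per geometric scale of
    the values of e, with ratio 4. Put L j = e 0 / 4 ^ j, say that n has level j
    when L (j + 1) < e n <= L j, and let m j be the first index with
    e (m j) <= L j, so that the indices of level j are those with
    m j <= n < m (j + 1). By a form of Riesz's lemma
    ([almost_orthogonal_vector]) there is x_ j in V (m (j + 1)) with F-norm at
    most 27/48 L j and at distance at least 25/48 L j from V (m (j + 1) - 1).

    The tail of the series from the index j on is then at most
    27/48 * 4/3 * L j = 3/4 L j, and the series converges to some x by
    completeness ([telescoping_majorant_series]). Let n have level j. The terms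
    of index less than j lie in V (m j), hence in V n, and do not affect the
    distance to V n; therefore
      dist (x, V n) <= 3/4 L j = 3 L (j + 1) <= 3 e n.
    As V n is contained in V (m (j + 1) - 1), the term x_ j alone is at distance
    at least 25/48 L j from V n, and the later terms change this by at most
    3/4 L (j + 1) = 9/48 L j; therefore
      dist (x, V n) >= 16/48 L j = L j / 3 >= e n / 3.
    A level may contain no index at all; its term still satisfies the same
    bounds and the estimates are unaffected.

    For the ratio 4, the values 25/48 and 27/48 make the two estimates meet the
    constants 1/3 and 3 exactly. In general a ratio q leaves the gap between
    these values that Riesz's lemma requires when (q - 3) (q - 6) < 0. *)

(** * Moduli of real and complex scalars *)

Section Modulus.
Context (R : realType) (k : scalar_kind).

Lemma modulus0 : modulus (0 : scalars R k) = 0.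
Proof.
case: k; first exact: (@normr0 R R).
exact: (congr1 (@complex.Re R) (@normr0 R[i] R[i])).
Qed.

Lemma modulusN1 : modulus (-1 : scalars R k) = 1.
Proof.
case: k; first exact: (@normrN1 R).
exact: (congr1 (@complex.Re R) (@normrN1 R[i])).
Qed.

Lemma modulus_surj (r : R) : 0 <= r -> exists t : scalars R k, modulus t = r.
Proof.
move=> r0; case: k => /=; first by exists r; exact: ger0_norm.
have rC : `|r%:C%C| = r%:C%C by rewrite ger0_norm// lecR.
by exists r%:C%C; exact: (congr1 (@complex.Re R) rC).
Qed.

End Modulus.

(** * Linear subspaces given as sets *)

Section Subspace.
Context (K : numFieldType) (X : lmodType K) (A : set X).
Context (subA : submod_closed (mem A)).

Lemma subspace0 : A 0.
Proof. by case: subA => /set_mem. Qed.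

Lemma subspace_lin (a : K) u v : A u -> A v -> A (a *: u + v).
Proof. by case: subA => _ h /mem_set Au /mem_set Av; exact/set_mem/h. Qed.

Lemma subspaceZ (a : K) u : A u -> A (a *: u).
Proof. by move=> Au; rewrite -[_ *: _]addr0; exact/subspace_lin/subspace0. Qed.

Lemma subspaceD u v : A u -> A v -> A (u + v).
Proof. by move=> Au Av; rewrite -[u]scale1r; exact: subspace_lin. Qed.

Lemma subspaceB u v : A u -> A v -> A (u - v).
Proof. by move=> Au Av; rewrite -scaleN1r addrC; exact: subspace_lin. Qed.

End Subspace.

(** * F-norms and distances to subspaces *)

Section Fnorm_theory.
Context (R : realType) (k : scalar_kind) (X : lmodType (scalars R k)).
Context (N : X -> R).
Context (FN : is_Fnorm N).

Lemma FnormN x : N (- x) = N x.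
Proof. by rewrite -scaleN1r (Fnorm_unimodular FN)// modulusN1. Qed.

Lemma FnormB x y : N (x - y) = N (y - x).
Proof. by rewrite -opprB FnormN. Qed.

Lemma Fnorm_ge0 x : 0 <= N x.
Proof.
have N0 : N 0 = 0 by exact/(Fnorm_eq0 FN).
(* 0 = N 0 <= N x + N (- x) = 2 N x *)
have := Fnorm_triangle FN x (- x); rewrite subrr N0 FnormN; lra.
Qed.

Lemma Fnorm_triangleB x y z : N (x - z) <= N (x - y) + N (y - z).
Proof. by have := Fnorm_triangle FN (x - y) (y - z); rewrite addrA subrK. Qed.

Lemma dist_le (x v : X) (V : set X) : V v -> dist N x V <= N (x - v).
Proof.
move=> Vv; apply: ge_inf; last by exists v.
by exists 0 => _ [w _ <-]; exact: Fnorm_ge0.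
Qed.

Lemma le_dist (x : X) (V : set X) (a : R) : V !=set0 ->
  (forall v, V v -> a <= N (x - v)) -> a <= dist N x V.
Proof.
move=> [v Vv] h; apply: lb_le_inf; first by exists (N (x - v)), v.
by move=> _ [w Vw <-]; exact: h.
Qed.

Lemma dist_lt (x : X) (V : set X) (b : R) : V !=set0 -> dist N x V < b ->
  exists2 v, V v & N (x - v) < b.
Proof.
move=> [v Vv] h.
have [||_ [w Vw <-] wb] := @inf_adherent R [set N (x - v) | v in V]
    (b - dist N x V).
- by rewrite subr_gt0.
- split; first by exists (N (x - v)), v.
  by exists 0 => _ [w _ <-]; exact: Fnorm_ge0.
- by exists w => //; move: wb; rewrite /dist; lra.
Qed.

(** The F-norm analogue of Riesz's lemma: a nearly best approximation v of y in
    V gives y - v, whose F-norm nearly equals its distance to V, and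
    s-convexity lets a scalar multiple reach any prescribed size, since the
    power function with exponent s maps the positive reals onto themselves. *)
Lemma almost_orthogonal_vector (s : R) (V W : set X) (y : X) (a b : R) :
  0 < s -> s_convex s N ->
  submod_closed (mem V) -> submod_closed (mem W) -> V `<=` W ->
  W y -> 0 < dist N y V -> 0 < a -> a < b ->
  exists x, [/\ W x, N x <= b & forall v, V v -> a <= N (x - v)].
Proof.
move=> s0 sN subV subW VW Wy d0 a0 ab; set d := dist N y V in d0.
have V0 : V !=set0 by exists 0; exact: subspace0.
(* The allowed loss b / a in the approximation is what scaling turns into b. *)
have [v Vv vlt] : exists2 v, V v & N (y - v) < b * d / a.
  by apply: dist_lt => //; rewrite ltr_pdivlMr// mulrC ltr_pM2r.
have r0 : 0 < a / d by exact: divr_gt0.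
have [t tE] := @modulus_surj R k ((a / d) `^ s^-1) (powR_ge0 _ _).
have tsE : modulus t `^ s = a / d.
  by rewrite tE -powRrM mulVf ?gt_eqF// powRr1// ltW.
have t0 : t != 0.
  apply/eqP => t0; move: tE; rewrite t0 modulus0 => /esym/eqP.
  by rewrite gt_eqF// powR_gt0.
exists (t *: (y - v)); split.
- by apply: subspaceZ => //; apply: subspaceB => //; exact: VW.
- rewrite sN tsE (le_trans (ler_wpM2l (ltW r0) (ltW vlt)))//.
  by rewrite le_eqVlt; apply/orP; left; apply/eqP; field; rewrite !gt_eqF.
- move=> w Vw.
  have -> : t *: (y - v) - w = t *: (y - (t^-1 *: w + v)).
    by rewrite !scalerBr scalerDr scalerA divff// scale1r opprD addrA addrAC.
  rewrite sN tsE.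
  have := dist_le y (subspace_lin subV t^-1 Vw Vv).
  rewrite -/d => /(ler_wpM2l (ltW r0)).
  by rewrite divfK ?gt_eqF.
Qed.

End Fnorm_theory.

(** * Closure and series in Fréchet spaces *)

Section Frechet_theory.
Context (R : realType) (k : scalar_kind).
Context (X : topologicalLmodType (scalars R k)).
Context (N : X -> R).
Context (FX : is_Frechet N).
Let FN : is_Fnorm N := Frechet_Fnorm FX.

(** The topology enters only here and in the completeness argument: a point at
    distance 0 from V has points of V in each of its N-balls. *)
Lemma dist_gt0 (y : X) (V : set X) : V !=set0 -> ~ closure V y ->
  0 < dist N y V.
Proof.
move=> V0; apply: contra_notP => /negP; rewrite -leNgt => d0 B.
rewrite (Frechet_nbhs FX) => -[r /= r0 rB].
have [v Vv vr] := dist_lt FN V0 (le_lt_trans d0 r0).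
by exists v; split => //; exact: rB.
Qed.

(** T n stands for the tail from n of a convergent series of real numbers that
    dominates the F-norms of the terms; working with the tails makes the bounds
    on the partial sums telescope, and these bounds pass to the limit. *)
Lemma telescoping_majorant_series (x : nat -> X) (T : nat -> R) :
  (forall n, N (x n) <= T n - T n.+1) -> T n @[n --> \oo] --> 0 ->
  exists l, forall n, N (l - \sum_(i < n) x i) <= T n.
Proof.
move=> xT T0.
pose S n := \sum_(i < n) x i.
have Tnincr : nonincreasing_seq T.
  apply/nonincreasing_seqP => n; rewrite -subr_ge0.
  exact: le_trans (Fnorm_ge0 FN _) (xT n).
have Tge0 n : 0 <= T n.
  have <- : limn T = 0 by exact/cvg_lim.
  apply: nonincreasing_cvgn_ge => //.
  by apply/cvg_ex; exists 0.
have SS m n : (m <= n)%N -> N (S n - S m) <= T m.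
  suff H j : N (S (m + j)%N - S m) <= T m - T (m + j)%N.
    by move=> /subnKC <-; rewrite (le_trans (H _))// gerBl.
  elim: j => [|j IH].
    by rewrite addn0 !subrr (Fnorm_eq0 FN 0).2.
  rewrite addnS /S big_ord_recr /= -/(S _).
  rewrite addrAC (le_trans (Fnorm_triangle FN _ _))//.
  by have := xT (m + j)%N; lra.
have Tsmall eps : 0 < eps -> exists M, T M < eps.
  move=> e0; have /cvgrPdist_lt/(_ eps e0)[M _ /(_ M (leqnn M))] := T0.
  by rewrite sub0r normrN ger0_norm//; exists M.
have [eps e0|l Sl] := @Frechet_complete _ _ _ _ FX S.
  have [|M TM] := Tsmall (eps / 2); first by rewrite divr_gt0.
  exists M => m n Mm Mn.
  have := Fnorm_triangleB FN (S m) (S M) (S n).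
  by rewrite (FnormB FN (S M)); have := SS _ _ Mm; have := SS _ _ Mn; lra.
exists l => n; apply/ler_addgt0Pr => eps e0.
have : nbhs l (ball_ N l eps).
  by rewrite (Frechet_nbhs FX); exists eps.
move=> /Sl [M _ /(_ _ (leq_maxl M n)) /= Seps].
have := Fnorm_triangleB FN l (S (maxn M n)) (S n).
by have := SS _ _ (leq_maxr M n); lra.
Qed.

End Frechet_theory.

(** * Prescribed distances to a nested sequence *)

Theorem theorem2p14 (R : realType) (k : scalar_kind)
    (X : topologicalLmodType (scalars R k)) (N : X -> R) (s : R)
    (V : nat -> set X) (e : nat -> R) :
  is_Frechet N ->
  0 < s <= 1 ->
  s_convex s N ->
  (forall n, submod_closed (mem (V n))) ->
  (forall n, closure (V n) `<` V n.+1) ->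
  (forall n, 0 < e n) ->
  nonincreasing_seq e ->
  e n @[n --> \oo] --> 0 ->
  exists x : X, forall n, e n / 3 <= dist N x (V n) <= 3 * e n.
Proof.
move=> FX /andP[s0 _] sN subV clV e_gt0 e_nincr e_to0.
have FN := Frechet_Fnorm FX.
have V_mono m n : (m <= n)%N -> V m `<=` V n.
  move=> /subnKC <-; elim: (n - m)%N => [|j IH]; first by rewrite addn0.
  rewrite addnS; apply: (subset_trans IH) => v Vv.
  exact/(properW (clV _))/subset_closure.
pose L j : R := e 0%N / 4 ^+ j.
have L_gt0 j : 0 < L j by rewrite divr_gt0// exprn_gt0.
have LS j : L j.+1 = L j / 4 by rewrite /L exprS invfM mulrCA mulrC.
have L_to0 c : c * L n @[n --> \oo] --> 0.
  rewrite -[X in _ --> X](mulr0 c); apply: cvgMr.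
  rewrite -[X in _ --> X](mulr0 (e 0%N)); apply: cvgMr.
  under eq_fun do rewrite -exprVn.
  by apply: cvg_expr; rewrite ger0_norm; lra.
have below eps : 0 < eps -> exists n, e n <= eps.
  move=> eps0; have /cvgrPdist_lt/(_ eps eps0)[M _ /(_ M (leqnn M))] := e_to0.
  by rewrite sub0r normrN gtr0_norm// => /ltW; exists M.
pose m j := ex_minn (below (L j) (L_gt0 j)).
have e_m j : e (m j) <= L j by rewrite /m; case: ex_minnP.
have m_min j n : e n <= L j -> (m j <= n)%N.
  by rewrite /m; case: ex_minnP => i _ h /h.
have m_mono j : (m j <= m j.+1)%N.
  by apply: m_min; have := e_m j.+1; have := L_gt0 j; rewrite LS; lra.
(* e 0 > L 1 forces m 1 > 0, so the predecessors of m j.+1 below are not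
   truncated. *)
have m_gt0 j : (0 < m j.+1)%N.
  elim: j => [|j IH]; last exact: leq_trans IH (m_mono _).
  rewrite lt0n; apply/eqP => m0; have := e_m 1%N.
  by rewrite m0 LS /L expr0 divr1; have := e_gt0 0%N; lra.
have step j : exists x, [/\ V (m j.+1) x, N x <= 27 / 48 * L j &
    forall v, V (m j.+1).-1 v -> 25 / 48 * L j <= N (x - v)].
  have := clV (m j.+1).-1; rewrite prednK// => -[clVW].
  move=> /existsNP[y /not_implyP[Wy ncly]].
  have V0 : V (m j.+1).-1 !=set0 by exists 0; exact: subspace0.
  have d0 := dist_gt0 FX V0 ncly.
  apply: (almost_orthogonal_vector FN s0 sN _ _ _ Wy d0) => //.
  - exact/V_mono/leq_pred.
  - by have := L_gt0 j; lra.
  - by have := L_gt0 j; lra.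
have {step}[x_ xP] := choice step.
have [|x x_tail] := @telescoping_majorant_series _ _ _ _ FX x_
    (fun j => 3 / 4 * L j) _ (L_to0 _).
  by move=> j; have [_ + _] := xP j; rewrite LS; lra.
exists x => n.
(* The level j of n is the least index with L j.+1 < e n. *)
have [j [Lj eL]] : exists j, L j.+1 < e n /\ e n <= L j.
  have ex : exists j, L j.+1 < e n.
    have /cvgrPdist_lt/(_ _ (e_gt0 n))[M _ /(_ M.+1 (leqnSn M))] := L_to0 1.
    by rewrite mul1r sub0r normrN gtr0_norm//; exists M.
  case: (ex_minnP ex) => -[|j] Lj jmin.
    by exists 0%N; split=> //; rewrite /L expr0 divr1; exact: e_nincr.
  by exists j.+1; split=> //; rewrite leNgt; apply/negP => /jmin; rewrite ltnn.
have mn : (m j <= n)%N by exact: m_min.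
have nm : (n <= (m j.+1).-1)%N.
  rewrite -ltnS prednK// ltnNge; apply/negP => /e_nincr.
  by have := e_m j.+1; lra.
have VS : V n (\sum_(i < j) x_ i).
  apply: (V_mono _ _ mn) => {mn nm Lj eL}; elim: j => [|j IH].
    by rewrite big_ord0; exact: subspace0.
  rewrite big_ord_recr /=; apply: subspaceD => //.
    exact: V_mono IH.
  by case: (xP j).
apply/andP; split.
- apply: le_dist => [|v Vv]; first by exists 0; exact: subspace0.
  have [_ _ /(_ _ (V_mono _ _ nm _ (subspaceB (subV n) Vv VS)))] := xP j.
  have -> : x_ j - (v - \sum_(i < j) x_ i) = \sum_(i < j.+1) x_ i - v.
    by rewrite big_ord_recr /= opprB addrCA addrA.
  have := Fnorm_triangleB FN (\sum_(i < j.+1) x_ i) x v.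
  rewrite (FnormB FN _ x); have := x_tail j.+1; rewrite LS; lra.
- apply: (le_trans (dist_le FN x VS)); rewrite (le_trans (x_tail j))//.
  by move: Lj; rewrite LS; lra.
Qed.
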